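(* Let $\mathcal{H}$ be a real Hilbert space and let $f:\mathcal{H}\to\mathbb{R}\cup\{+\infty\}$ be a proper, lower semicontinuous, convex function such that $S:=\operatorname{argmin} f\neq\emptyset$. Let $s_0>0$, assume that $\alpha>1$, and let $x:[s_0,+\infty[\to\mathcal{H}$ be a solution trajectory (in the generalized sense given in the context) of $$\ddot x(s)+\frac{\alpha}{s}\dot x(s)+\partial f\left(x(s)+\frac{s}{\alpha-1}\dot x(s)\right)\ni 0$$ which satisfies the initial conditions $x(s_0)\in\operatorname{dom} f$ and $\dot x(s_0)=0$. Set $y(s):=x(s)+\frac{s}{\alpha-1}\dot x(s)$. Then: (i) $x(s)$ converges weakly as $s\to+\infty$, and its limit belongs to $S$. If $\alpha>3$, then (ii) $f(y(s))-\inf_{\mathcal{H}}f=o\left(\frac1{s^2}\right)$ as $s\to+\infty$.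
   Context: $\partial f$ denotes the convex subdifferential of $f$ and $\operatorname{dom} f=\{u\in\mathcal{H}: f(u)<+\infty\}$. A (generalized) solution trajectory of the second-order inclusion is a function $x$ such that, with $y(s)=x(s)+\frac{s}{\alpha-1}\dot x(s)$, the pair $(y,x)$ is a strong solution on $[s_0,+\infty[$ of the first-order system $$\begin{cases}\dot y(s)+\frac{s}{\alpha-1}\partial f(y(s))\ni 0\\ \dot x(s)+\frac{\alpha-1}{s}(x(s)-y(s))=0,\end{cases}$$ that is, $y$ and $x$ are locally absolutely continuous and continuous on $[s_0,+\infty[$ and the relations hold for almost every $s\ge s_0$ (the second one for every $s$, so that $x$ is $\mathcal{C}^1$). The initial conditions then amount to $y(s_0)=x(s_0)\in\operatorname{dom} f$. *)

(* Defs.v *)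
From HB Require Import structures.
From mathcomp Require Import all_boot all_order all_algebra.
From mathcomp Require Import all_classical all_reals all_analysis.

Set Implicit Arguments.
Unset Strict Implicit.
Unset Printing Implicit Defensive.

Import Order.TTheory GRing.Theory Num.Theory.
Import numFieldNormedType.Exports.

Local Open Scope classical_set_scope.
Local Open Scope ring_scope.

(* Lets the notation f =o_+oo g typecheck, as eventually_filterType does for
   sequences. *)
Canonical pinfty_filterType (R : numFieldType) := FilterType (pinfty_nbhs R) _.

Definition edom {R : realType} {H : Type} (f : H -> \bar R) : set H :=
  [set u | (f u < +oo)%E].

Definition proper_fun {R : realType} {H : Type} (f : H -> \bar R) : Prop :=
  (forall u, f u != -oo%E) /\ edom f !=set0.

(* At t = 0 and t = 1 the convention 0 * +oo = 0 makes the inequality trivial. *)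
Definition econvex {R : realType} {H : lmodType R} (f : H -> \bar R) : Prop :=
  forall (u v : H) (t : R), 0 <= t <= 1 ->
    (f (t *: u + (1 - t) *: v)%R <= t%:E * f u + (1 - t)%:E * f v)%E.

Definition argmin {R : realType} {H : Type} (f : H -> \bar R) : set H :=
  [set u | forall v, (f u <= f v)%E].

(* For proper f this set is empty when f u = +oo. *)
Definition subdiff {R : realType} {H : lmodType R} (dot : {dot H for idfun})
    (f : H -> \bar R) (u : H) : set H :=
  [set xi | forall v, (f u + (dot xi (v - u)%R)%:E <= f v)%E].

Definition weak_cvg {R : realType} {H : lmodType R} (dot : {dot H for idfun})
    {T : Type} (F : set_system T) (x : T -> H) (l : H) : Prop :=
  forall v : H, dot (x t) v @[t --> F] --> dot l v.

Section HalfLine.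
Context {R : realType} {H : completeNormedModType R}.
Implicit Types (s a b : R) (z : R -> H).

(* Trajectories on [s0, +oo[ are total functions on R whose values below s0
   are never used: the derivative is two-sided at s > s0 and the right
   derivative at s0. *)
Definition diff_quot z s : R -> H := fun t => (t - s)^-1 *: (z t - z s).

Definition derivable_from (s0 : R) z s : Prop :=
  cvg (diff_quot z s t @[t --> within `[s0, +oo[ (s^')]).

Definition derive_from (s0 : R) z s : H :=
  lim (diff_quot z s t @[t --> within `[s0, +oo[ (s^')]).

Definition abs_continuous a b z : Prop :=
  forall e : R, 0 < e -> exists2 d : R, 0 < d &
    forall (n : nat) (l r : 'I_n -> R),
      (forall i, a <= l i <= r i /\ r i <= b) ->
      trivIset setT (fun i => `]l i, r i[%classic) ->
      \sum_(i < n) (r i - l i) < d ->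
      \sum_(i < n) `|z (r i) - z (l i)| < e.

Definition loc_abs_continuous (s0 : R) z : Prop :=
  forall a b, s0 <= a -> a <= b -> abs_continuous a b z.

Definition strong_solution (dot : {dot H for idfun}) (f : H -> \bar R)
    (alpha s0 : R) (y x : R -> H) : Prop :=
  [/\ loc_abs_continuous s0 y /\ {within `[s0, +oo[, continuous y},
      loc_abs_continuous s0 x /\ {within `[s0, +oo[, continuous x},
      {ae (@lebesgue_measure R), forall s, s0 <= s ->
        derivable_from s0 y s /\
        exists2 xi, subdiff dot f (y s) xi &
          derive_from s0 y s + (s / (alpha - 1)) *: xi = 0} &
      forall s, s0 <= s ->
        derivable_from s0 x s /\
        derive_from s0 x s + ((alpha - 1) / s) *: (x s - y s) = 0].

Definition y_of (alpha s0 : R) (x : R -> H) : R -> H :=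
  fun s => x s + (s / (alpha - 1)) *: derive_from s0 x s.

Definition solution_trajectory (dot : {dot H for idfun}) (f : H -> \bar R)
    (alpha s0 : R) (x : R -> H) : Prop :=
  strong_solution dot f alpha s0 (y_of alpha s0 x) x.

End HalfLine.

(* Main.v *)
Require Import Defs.
From HB Require Import structures.
From mathcomp Require Import all_boot all_order all_algebra.
From mathcomp Require Import all_classical all_reals all_analysis.
From mathcomp Require Import ring lra.

Set Implicit Arguments.
Unset Strict Implicit.
Unset Printing Implicit Defensive.

Import Order.TTheory GRing.Theory Num.Theory.
Import numFieldNormedType.Exports.

Local Open Scope classical_set_scope.
Local Open Scope ring_scope.

(** In the inclusion, [y] moves by steepest descent: with [c = 1 / (alpha - 1)],
    [y' = - c s xi] for some [xi] in the subdifferential of [f] at [y s], for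
    almost every [s] (it is the gradient flow of [f] run with the clock
    [c s^2 / 2]). The second relation, [x' = (alpha - 1) / s * (y - x)], says that
    [s^(alpha - 1) x] has derivative [(alpha - 1) s^(alpha - 2) y], so that [x] is
    a weighted average of [y] whose total weight tends to infinity. Everything is
    therefore proved for [y], and weak convergence passes to [x] ([average_cvg]).

    One differential inequality feeds the whole argument. By definition of a
    subgradient, [|y s - v|^2] has derivative [2 c s <xi, v - y s>], which is at
    most [2 c s (f v - f (y s))]. Integrated ([flow_sqdist_le]): if
    [f v <= f (y s) + k] on [[a, b]], then
    [|y b - v|^2 - |y a - v|^2 <= k c (b^2 - a^2)]. The integration needs that an
    absolutely continuous function with nonpositive derivative almost everywhere
    is nonincreasing ([ac_nonincreasing]), which is proved directly, by covering
    the exceptional null set with a small open set and inducting along the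
    interval. Three choices of [v] and [k] are used.

    - [f] is nonincreasing along [y] ([flow_value_nonincreasing]), with no chain
      rule for [f] composed with [y]. If [f (y b) > f (y a)], let [t] be the last
      time before [b] at which [f (y t) <= f (y a)]; it exists because [f] is
      lower semicontinuous. After [t] all values exceed [f (y t)], so taking
      [v = y t] and [k = 0] shows that [y] has not moved: [y b = y t], a
      contradiction.
    - For a minimizer [z], taking [k = 0] shows that [|y s - z|] is nonincreasing.
    - For a minimizer [z], taking [k = - (f (y b) - min f)], which the
      monotonicity of the values permits, gives
      [c (b^2 - a^2) (f (y b) - min f) <= |y a - z|^2 - |y b - z|^2]
      ([value_gap_decrease]). With [a = b / 2] the right-hand side tends to [0],
      because [|y s - z|] converges, and hence [b^2 (f (y b) - min f)] tends to
      [0].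

    Since the values converge to the minimum, and closed convex sublevel sets are
    weakly closed ([closed_convex_weak_closed]), every weak cluster point of [y]
    is a minimizer; as the distances to minimizers converge, Opial's argument
    ([opial]) gives a single weak limit. Cluster points are taken along
    ultrafilters, for which weak compactness of balls amounts to compactness of
    real segments together with the Riesz representation of the limiting
    functional ([ultra_bounded_weak_cvg]). *)

(** * Absolutely continuous functions with nonpositive derivative *)

(** Cousin's lemma as an induction principle: around every [t] a property can be
    carried backwards from the right of [t] to the left of [t], both endpoints
    being allowed to equal [t]. The infimum of the points reached is itself
    reached, and cannot exceed [a]. *)
Lemma backward_induction (R : realType) (a b : R) (P : R -> Prop) :
  a <= b -> P b ->
  (forall t, a <= t <= b -> exists2 d, 0 < d & forall u v,
     [/\ a <= u, t - d < u & u <= t] -> [/\ t <= v, v < t + d & v <= b] ->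
     P v -> P u) ->
  P a.
Proof.
move=> ab Pb step; pose S := [set t | a <= t <= b /\ P t].
have Sb : S b by split=> //; rewrite ab lexx.
have Slb : lbound S a by move=> t [/andP[]].
have infS : has_inf S by split; [exists b | exists a].
have Sge u : S u -> inf S <= u by apply: (inf_lbound infS.2).
have am : a <= inf S by apply: lb_le_inf => //; exists b.
have mb : inf S <= b := Sge _ Sb.
have [|d d0 stepm] := step (inf S); first by rewrite am mb.
have [v [/andP[av vb] Pv] vm] := inf_adherent d0 infS.
have mv : inf S <= v by apply: Sge; split=> //; rewrite av vb.
pose u := Num.max a (inf S - d / 2).
have um : u <= inf S by rewrite ge_max am /=; lra.
have Pu : P u.
  apply: (stepm u v) => //; split=> //; first by rewrite le_max lexx.
  by rewrite lt_max; apply/orP; right; lra.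
have : inf S <= u.
  by apply: Sge; split=> //; rewrite le_max lexx/= (le_trans um).
rewrite le_max => /orP[ma|]; last by lra.
suff <- : u = a by [].
by apply/eqP; rewrite eq_le (le_trans um)//= le_max lexx.
Qed.

Lemma sum_length_le_lebesgue (R : realType) (U : set R) n (l r : 'I_n -> R) :
  open U -> (forall i, l i <= r i) ->
  trivIset setT (fun i => `]l i, r i[%classic) ->
  (forall i, `]l i, r i[ `<=` U) ->
  ((\sum_(i < n) (r i - l i))%:E <= lebesgue_measure U)%E.
Proof.
move=> oU lr tr sub.
have -> : ((\sum_(i < n) (r i - l i))%:E
    = \sum_(i < n) lebesgue_measure `]l i, r i[%classic)%E.
  rewrite -sumEFin; apply: eq_bigr => i _.
  rewrite lebesgue_measure_itv/= lte_fin EFinB; case: ltP => // rl.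
  by rewrite -EFinB; congr EFin; apply/eqP; rewrite subr_eq0 eq_le rl lr.
rewrite -measure_bigsetU_ord//.
apply: le_measure; rewrite ?inE.
- by apply: bigsetU_measurable => i _; apply: measurable_itv.
- exact: measurable_realfun.open_measurable.
- by elim/big_ind: _ => [|X Y XU YU t [/XU|/YU]|i _] //; exact: sub.
Qed.

Lemma null_set_open_cover (R : realType) (N : set R) (d : R) : 0 < d ->
  (@lebesgue_measure R).-negligible N ->
  exists U, [/\ open U, N `<=` U & (lebesgue_measure U < d%:E)%E].
Proof.
move=> d0 [A [mA A0 NA]].
have [|U [oU AU Ud]] := lebesgue_regularity_outer mA _ d0.
  by move: A0 => /= ->; rewrite ltry.
exists U; split=> //; first exact: subset_trans AU.
have mU := measurable_realfun.open_measurable oU.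
rewrite -[U](setDKU AU); apply: le_lt_trans; first apply: measureU2 => //.
- exact: measurableD.
- by move: A0 => /= ->; rewrite adde0.
Qed.

(** An upper bound on the difference quotients based at [t] bounds the increments
    over every interval around [t]: the interval is cut at [t]. *)
Lemma quotient_straddle (R : realType) (g : R -> R) (a b t e : R) :
  (\forall u \near within `[a, b] (t^'), (u - t)^-1 * (g u - g t) <= e) ->
  exists2 d, 0 < d & forall u v,
     [/\ a <= u, t - d < u & u <= t] -> [/\ t <= v, v < t + d & v <= b] ->
     g v - g u <= e * (v - u).
Proof.
move=> /nbhs_ballP[d /= d0 ball_le]; exists d => // u v [au tu ut] [tv vt vb].
have right : g v - g t <= e * (v - t).
  move: tv; rewrite le_eqVlt => /predU1P[<-|tv]; first by rewrite !subrr mulr0.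
  have : (v - t)^-1 * (g v - g t) <= e.
    apply: ball_le; rewrite /ball/= ?gt_eqF// ?in_itv/= ?vb ?andbT//; last by lra.
    by rewrite ltr0_norm; lra.
  by rewrite mulrC ler_pdivrMr ?subr_gt0.
have left : g t - g u <= e * (t - u).
  move: ut; rewrite le_eqVlt => /predU1P[<-|ut]; first by rewrite !subrr mulr0.
  have : (u - t)^-1 * (g u - g t) <= e.
    apply: ball_le; rewrite /ball/= ?lt_eqF// ?in_itv/= ?au ?andTb//; last by lra.
    by rewrite gtr0_norm; lra.
  rewrite -mulrNN -invrN !opprB mulrC ler_pdivrMr ?subr_gt0//.
lra.
Qed.

(** The null set where the derivative is not controlled is covered by an open [U]
    of measure so small that, by absolute continuity, [g] varies by less than [e]
    on any disjoint intervals inside [U]. Going from [b] down to [a], the growth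
    of [g] is charged either to the slope [e], near a good point, or to one more
    interval contained in [U], near a bad one. *)
Lemma ac_nonincreasing (R : realType) (g : R -> R) (a b : R) : a <= b ->
  abs_continuous a b (g : R -> R^o) ->
  {ae (@lebesgue_measure R), forall t, a <= t <= b -> forall e, 0 < e ->
    \forall u \near within `[a, b] (t^'), (u - t)^-1 * (g u - g t) <= e} ->
  g b <= g a.
Proof.
move=> ab gac; set Q := (fun t => _) => aeQ.
suff main e : 0 < e -> g b - g a <= e * (b - a) + e.
  rewrite -subr_le0; apply/ler_addgt0Pl => e e0; rewrite addr0.
  have c0 : 0 < b - a + 1 by lra.
  have := main (e / (b - a + 1)) (divr_gt0 e0 c0).
  suff -> : e / (b - a + 1) * (b - a) + e / (b - a + 1) = e by [].
  by field; lra.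
move=> e0; have [d d0 gd] := gac e e0.
have [U [oU NU Ud]] := null_set_open_cover d0 aeQ.
(* [P t]: the increase of [g] on [[t, b]] is accounted for by the slope [e] and
   by finitely many disjoint intervals of [U] lying in [[t, b]]. *)
pose P t := exists n (l r : 'I_n -> R), [/\ forall i, t <= l i <= r i /\ r i <= b,
   trivIset setT (fun i => `]l i, r i[%classic),
   forall i, `]l i, r i[ `<=` U &
   g b - g t <= e * (b - t) + \sum_(i < n) `|g (r i) - g (l i)|].
suff [n [l [r [lr tr sub gP]]]] : P a.
  apply: (le_trans gP); rewrite lerD2l; apply/ltW/gd => //.
  rewrite -lte_fin (le_lt_trans _ Ud)// sum_length_le_lebesgue// => i.
  by have [/andP[]] := lr i.
apply: (backward_induction ab).
  exists 0, (fun=> 0), (fun=> 0); split => [[]//|[]//|[]//|].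
  by rewrite big_ord0 !subrr mulr0 addr0.
move=> t tab; have [Qt|Qt] := pselect (Q t).
  have [dt dt0 step] := quotient_straddle (Qt tab e e0).
  exists dt => // u v hu hv [n [l [r [lr tr sub gP]]]].
  exists n, l, r; split=> // [i|].
    have [/andP[vl ->] ->] := lr i; rewrite andbT; split=> //.
    by case: hu hv => _ _ ut [tv _ _]; lra.
  by have := step u v hu hv; lra.
have Ut : U t by exact: NU.
have [dt /= dt0 ball_U] : exists2 dt, 0 < dt & `]t - dt, t + dt[ `<=` U.
  have /nbhs_ballP[dt /= dt0 bU] := open_nbhs_nbhs (conj oU Ut).
  by exists dt => //; rewrite -ball_itv.
exists dt => // u v [au tu ut] [tv vt vb] [n [l [r [lr tr sub gP]]]].
(* The interval [[u, v]] becomes the one of index [0]. *)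
pose l' i := if unlift ord0 i is Some j then l j else u.
pose r' i := if unlift ord0 i is Some j then r j else v.
exists n.+1, l', r'; split => [i|i j _ _|i|].
- rewrite /l' /r'; case: unliftP => [j _|_]; last by rewrite lexx (le_trans ut).
  have [/andP[vl ->] ->] := lr j; rewrite andbT; split => //; lra.
- rewrite /l' /r'; case: unliftP => [i' ->|->]; case: unliftP => [j' ->|->] //.
  + by move=> /(tr _ _ I I) ->.
  + have [/andP[vl _] _] := lr i'.
    move=> [z [/=]]; rewrite !in_itv/= => /andP[? _] /andP[_ ?]; exfalso; lra.
  + have [/andP[vl _] _] := lr j'.
    move=> [z [/=]]; rewrite !in_itv/= => /andP[_ ?] /andP[? _]; exfalso; lra.
- rewrite /l' /r'; case: unliftP => [j _|_]; first exact: sub.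
  move=> z /=; rewrite in_itv/= => /andP[? ?].
  by apply: ball_U; rewrite /= in_itv/=; apply/andP; split; lra.
- rewrite big_ord_recl {1 2}/l' {1 2}/r' unlift_none.
  under eq_bigr => i _ do rewrite /l' /r' liftK.
  have := ler_norm (g v - g u); have : 0 <= e * (v - u) by apply: mulr_ge0; lra.
  move: gP => /=; lra.
Qed.

Lemma abs_continuous_dominated (R : realType) (H K : completeNormedModType R)
    (y : R -> H) (g : R -> K) (a b C : R) : 0 <= C ->
  (forall l r, a <= l -> l <= r -> r <= b ->
     `|g r - g l| <= C * (`|y r - y l| + (r - l))) ->
  abs_continuous a b y -> abs_continuous a b g.
Proof.
move=> C0 gy yac e e0.
have C1 : 0 < 2 * (C + 1) by lra.
have e10 : 0 < e / (2 * (C + 1)) by rewrite divr_gt0.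
have [d d0 yd] := yac _ e10.
exists (Num.min d (e / (2 * (C + 1)))) => [|n l r lr tr]; first by rewrite lt_min d0.
rewrite lt_min => /andP[sd se].
apply: (@le_lt_trans _ _
  (C * (\sum_(i < n) `|y (r i) - y (l i)| + \sum_(i < n) (r i - l i)))).
  rewrite -big_split mulr_sumr/=; apply: ler_sum => i _.
  by have [/andP[? ?] ?] := lr i; apply: gy.
have := yd n l r lr tr sd.
set S := \sum_(i < n) _ in se *; set T := \sum_(i < n) _ => Te.
have : C * (T + S) <= C * (e / (C + 1)).
  apply: ler_wpM2l => //.
  have -> : e / (C + 1) = e / (2 * (C + 1)) + e / (2 * (C + 1)).
    by field; lra.
  by rewrite ltW// ltrD.
move=> /le_lt_trans; apply; rewrite mulrCA gtr_pMr// ltr_pdivrMr; lra.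
Qed.

(** * Inner products *)

Section hilbert.
Context {R : realType} {H : completeNormedModType R} (dot : {dot H for idfun}).
Hypothesis norm_dot : forall u : H, `|u| ^+ 2 = dot u u.
Implicit Types u v w : H.

Lemma dotC u v : dot u v = dot v u.
Proof. by rewrite [LHS]hermC/= expr0 mul1r. Qed.

Lemma dotDr w u v : dot w (u + v) = dot w u + dot w v.
Proof. exact: linearDr. Qed.

Lemma dotNr w u : dot w (- u) = - dot w u.
Proof. exact: linearNr. Qed.

Lemma dotZr w (k : R) u : dot w (k *: u) = k * dot w u.
Proof. exact: linearZr. Qed.

Lemma dotDl w u v : dot (u + v) w = dot u w + dot v w.
Proof. by rewrite dotC dotDr !(dotC w). Qed.

Lemma dotNl w u : dot (- u) w = - dot u w.
Proof. by rewrite dotC dotNr dotC. Qed.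

Lemma dotZl w (k : R) u : dot (k *: u) w = k * dot u w.
Proof. by rewrite dotC dotZr dotC. Qed.

Definition dotE := (dotDl, dotDr, dotNl, dotNr, dotZl, dotZr).

Lemma sqr_normD u v : `|u + v| ^+ 2 = `|u| ^+ 2 + 2 * dot u v + `|v| ^+ 2.
Proof. by rewrite !norm_dot !dotE (dotC v); ring. Qed.

Lemma sqr_normB u v : `|u - v| ^+ 2 = `|u| ^+ 2 - 2 * dot u v + `|v| ^+ 2.
Proof. by rewrite sqr_normD dotNr normrN; ring. Qed.

Lemma sqr_norm_sub u v : `|u| ^+ 2 - `|v| ^+ 2 = dot (u - v) (u + v).
Proof. by rewrite !norm_dot !dotE (dotC v); ring. Qed.

(** Cauchy-Schwarz is read off the triangle inequality for the norm of [u + v]. *)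
Lemma dot_le u v : `|dot u v| <= `|u| * `|v|.
Proof.
have le w : dot u w <= `|u| * `|w|.
  have : `|u + w| ^+ 2 <= (`|u| + `|w|) ^+ 2.
    by rewrite lerXn2r ?nnegrE ?addr_ge0// ler_normD.
  by rewrite sqr_normD sqrrD -mulr_natl; lra.
by rewrite ler_norml le andbT -lerN2 opprK -dotNr -(normrN v).
Qed.

(** Joint continuity of the inner product follows from that of the norm, by
    polarization. *)
Lemma cvg_dot {T : Type} (F : set_system T) {FF : Filter F} (p q : T -> H) u v :
  p @ F --> u -> q @ F --> v -> dot (p t) (q t) @[t --> F] --> dot u v.
Proof.
have polar u' v' : dot u' v' = (`|u' + v'| ^+ 2 - `|u'| ^+ 2 - `|v'| ^+ 2) * 2^-1.
  by rewrite sqr_normD; field.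
move=> pu qv; rewrite polar; under eq_fun do rewrite polar.
have sq z w : z @ F --> w -> `|z t| ^+ 2 @[t --> F] --> (`|w| ^+ 2 : R).
  by move=> /cvg_norm zw; exact: cvgM.
by apply: cvgMl; apply: cvgB; [apply: cvgB|]; apply: sq => //; exact: cvgD.
Qed.
End hilbert.

(** * Weak limits in a Hilbert space *)

Section weak_limits.
Context {R : realType} {H : completeNormedModType R} (dot : {dot H for idfun}).
Hypothesis norm_dot : forall u : H, `|u| ^+ 2 = dot u u.

Lemma parallelogram (u v : H) :
  `|u - v| ^+ 2 = 2 * (`|u| ^+ 2 + `|v| ^+ 2) - 4 * `|2^-1 *: u + 2^-1 *: v| ^+ 2.
Proof. by rewrite !norm_dot !(dotE dot) (dotC dot v); field. Qed.

(** The minimizer over [C] of [J w = |w|^2 - 2 phi w], characterized by its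
    variational inequality. Near-minimizers form a Cauchy filter, by the
    parallelogram identity applied to midpoints. With [C] the whole space this is
    the Riesz representation of [phi]; with [phi = dot u] it is the projection of
    [u] on [C]. *)
Lemma quadratic_argmin (phi : H -> R) (M : R) (C : set H) :
  (forall a u v, phi (a *: u + v) = a * phi u + phi v) ->
  (forall v, `|phi v| <= M * `|v|) ->
  C !=set0 -> closed C ->
  (forall u v t, C u -> C v -> 0 <= t <= 1 -> C (t *: u + (1 - t) *: v)) ->
  exists2 u, C u & forall w, C w -> phi (w - u) <= dot u (w - u).
Proof.
move=> phi_lin phi_le [w0 Cw0] C_closed C_cvx.
have phiD u v : phi (u + v) = phi u + phi v.
  by rewrite -[u]scale1r phi_lin mul1r scale1r.
have phi0 : phi 0 = 0 by have := phiD 0 0; rewrite addr0; lra.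
have phiZ a u : phi (a *: u) = a * phi u by rewrite -[a *: u]addr0 phi_lin phi0 addr0.
have phiB u v : phi (u - v) = phi u - phi v by rewrite phiD -scaleN1r phiZ mulN1r.
pose J w := `|w| ^+ 2 - 2 * phi w.
have infJ : has_inf [set J w | w in C].
  split; first by exists (J w0), w0.
  exists (- M ^+ 2) => _ [w _ <-]; have := phi_le w; rewrite ler_norml => /andP[_ le].
  by have := sqr_ge0 (`|w| - M); rewrite /J sqrrB -mulr_natl; lra.
set I := inf [set J w | w in C] in infJ *.
have IJ w : C w -> I <= J w by move=> Cw; apply: (inf_lbound infJ.2); exists w.
have near_min e : 0 < e -> exists2 w, C w & J w < I + e.
  by move=> e0; have [_ [w Cw <-] We] := inf_adherent e0 infJ; exists w.
have dist_le u v e : C u -> C v -> J u < I + e -> J v < I + e -> `|u - v| ^+ 2 <= 4 * e.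
  move=> Cu Cv Ju Jv; have := C_cvx u v 2^-1 Cu Cv.
  rewrite (_ : 1 - 2^-1 = 2^-1); last by field.
  have h : 0 <= (2^-1 : R) <= 1 by apply/andP; split; lra.
  move=> /(_ h) /IJ; rewrite parallelogram {1}/J phiD !phiZ.
  move: Ju Jv; rewrite /J; lra.
pose F : set_system H :=
  [set A | exists2 e, 0 < e & forall w, C w -> J w < I + e -> A w].
have FF : ProperFilter F.
  split=> [[e e0 Fe]|]; first by have [w Cw Jw] := near_min e e0; exact: Fe Jw.
  split=> [|A B [e e0 Ae] [d d0 Bd]|A B AB [e e0 Ae]].
  - by exists 1.
  - exists (Num.min e d) => [|w Cw Jw]; first by rewrite lt_min e0.
    have : J w - I < Num.min e d by lra.
    by rewrite lt_min => /andP[? ?]; split; [apply: Ae|apply: Bd] => //; lra.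
  - by exists e => // w Cw Jw; apply/AB/Ae.
have Fcauchy : cauchy F.
  apply/cauchy_exP => e e0; have e1 : 0 < e ^+ 2 / 8 by rewrite divr_gt0 ?exprn_gt0.
  have [w Cw Jw] := near_min _ e1; exists w, (e ^+ 2 / 8) => // v Cv Jv.
  rewrite -ball_normE/= -(@ltr_pXn2r _ 2)// ?nnegrE ?(ltW e0)//.
  apply: le_lt_trans (dist_le _ _ _ Cw Cv Jw Jv) _.
  by have := exprn_gt0 2 e0; lra.
pose u := lim F; have Fu : id v @[v --> F] --> u by exact: cauchy_cvg Fcauchy.
have FC : F C by exists 1.
have Cu : C u by exact: (closed_cvg (u_ := id) C C_closed FC _ Fu).
have Fphi : phi v @[v --> F] --> phi u.
  apply/cvgrPdist_le => e e0; have M0 : 0 < `|M| + 1 by rewrite ltr_wpDl.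
  move/cvgrPdist_le: (Fu) => /(_ _ (divr_gt0 e0 M0)); apply: filterS => v.
  rewrite ler_pdivlMr// => uv; rewrite -phiB; apply: le_trans (phi_le _) _.
  have := ler_wpM2r (normr_ge0 (u - v)) (ler_norm M); have := normr_ge0 (u - v); lra.
have FJ : J v @[v --> F] --> J u.
  apply: cvgB; last by apply: cvgMr.
  by apply: cvgM; apply: cvg_norm.
have JuI : J u <= I.
  apply/ler_addgt0Pr => e e0.
  have Fe : F [set v | J v <= I + e] by exists e => // v Cv /ltW.
  exact: (closed_cvg (u_ := J) (fun r => r <= I + e) (@closed_le _ _) Fe _ FJ).
exists u => // w Cw; rewrite leNgt; apply/negP; rewrite -subr_gt0; set d := w - u.
set k := phi d - dot u d => k0; have d2 : 0 <= `|d| ^+ 2 by rewrite sqr_ge0.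
have dk0 : 0 < `|d| ^+ 2 + k by lra.
(* Moving from [u] towards [w] changes [J] by [t (t |d|^2 - 2 k)], which is
   negative for this [t] since then [t |d|^2 < k]. *)
pose t := k / (`|d| ^+ 2 + k).
have t0 : 0 < t by rewrite divr_gt0.
have t01 : 0 <= t <= 1.
  by rewrite (ltW t0) ler_pdivrMr// mul1r lerDr.
have := IJ _ (C_cvx w u t Cw Cu t01).
have -> : t *: w + (1 - t) *: u = u + t *: d.
  by rewrite /d scalerBl scale1r scalerBr addrCA.
rewrite /J (sqr_normD norm_dot) normrZ exprMn real_normK ?num_real//.
rewrite phiD phiZ dotZr => le.
have : t * (`|d| ^+ 2 + k) = k by rewrite /t divfK ?gt_eqF.
have : 0 <= t * (t * `|d| ^+ 2 - 2 * k) by move: le JuI; rewrite /J /k; lra.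
rewrite pmulr_rge0//; have : 0 < t * k by rewrite mulr_gt0.
lra.
Qed.

Lemma riesz_representation (phi : H -> R) (M : R) :
  (forall a u v, phi (a *: u + v) = a * phi u + phi v) ->
  (forall v, `|phi v| <= M * `|v|) ->
  exists u, phi = dot u.
Proof.
move=> phi_lin phi_le.
have [||//|u _ u_min] := @quadratic_argmin phi M setT phi_lin phi_le.
- by exists 0.
- exact: closedT.
have le v : phi v <= dot u v by have := u_min (v + u) I; rewrite addrK.
exists u; apply/funext => v; apply/eqP; rewrite eq_le le/=.
have phi0 : phi 0 = 0 by have := phi_lin 1 0 0; rewrite scale1r addr0; lra.
have := le (- v); rewrite dotNr -[- v]addr0 -scaleN1r phi_lin phi0; lra.
Qed.

(** Let [p] be the projection of the weak limit [u] on [C]. Since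
    [dot (x t - p) (u - p) <= 0] whenever [x t] is in [C], the limit gives
    [|u - p|^2 <= 0]. *)
Lemma closed_convex_weak_closed {T : Type} (G : set_system T) {GG : ProperFilter G}
    (x : T -> H) (u : H) (C : set H) :
  closed C -> (forall u v t, C u -> C v -> 0 <= t <= 1 -> C (t *: u + (1 - t) *: v)) ->
  (\forall t \near G, C (x t)) -> weak_cvg dot G x u -> C u.
Proof.
move=> C_closed C_cvx GC xu.
have [|||//|//|p Cp p_proj] := @quadratic_argmin (dot u) `|u| C.
- by move=> a v w; rewrite !dotE.
- exact: dot_le.
- by have [t] := filter_ex GC; exists (x t).
suff <- : p = u by [].
have : dot (u - p) (u - p) <= 0.
  have near_le0 : \forall t \near G, dot (x t - p) (u - p) <= 0.
    apply: filterS GC => t /p_proj.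
    by rewrite !(dotE dot) (dotC dot u (x t)) (dotC dot p (x t)) (dotC dot u p); lra.
  apply: (closed_cvg (u_ := fun t => dot (x t - p) (u - p)) (fun r => r <= 0)
    (@closed_le _ _) near_le0).
  rewrite dotDl; under eq_fun do rewrite dotDl.
  by apply: cvgD; [exact: xu|exact: cvg_cst].
rewrite -norm_dot => up; apply/esym/eqP; rewrite -subr_eq0 -normr_eq0 -sqrf_eq0.
by rewrite eq_le up sqr_ge0.
Qed.

Lemma closed_sublevel (f : H -> \bar R) (r : R) :
  lower_semicontinuous f -> closed [set u | (f u <= r%:E)%E].
Proof.
move=> /lower_semicontinuousP/(_ r)/open_closedC; congr closed.
by apply/seteqP; split=> u /=; rewrite leNgt => /negP.
Qed.

Lemma convex_sublevel (f : H -> \bar R) (r : R) : econvex f -> forall u v t,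
  (f u <= r%:E)%E -> (f v <= r%:E)%E -> 0 <= t <= 1 ->
  (f (t *: u + (1 - t) *: v)%R <= r%:E)%E.
Proof.
move=> f_cvx u v t fu fv t01; apply: le_trans (f_cvx u v t t01) _.
have /andP[t0 t1] := t01.
have -> : r%:E = (t%:E * r%:E + (1 - t)%:E * r%:E)%E.
  by rewrite -!EFinM -EFinD; congr EFin; ring.
by apply: leeD; apply: lee_wpmul2l => //; rewrite lee_fin// subr_ge0.
Qed.

Lemma ultra_fmap {T U : Type} (G : set_system T) (g : T -> U) :
  UltraFilter G -> UltraFilter (g @ G).
Proof.
move=> GU; have GP := @ultra_proper _ _ GU; split; first exact: fmap_proper_filter.
move=> K KP sub; apply/seteqP; split=> [A KA|//].
have [//|GA] := in_ultra_setVsetC (g @^-1` A) GU.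
have KA' : K (~` A) by exact: sub.
have : K (A `&` ~` A) by exact: filterI.
by move=> /filter_ex[u []].
Qed.

(** Weak compactness of balls. Along an ultrafilter each bounded real function
    [dot (x t) v] converges; its limit is linear and bounded in [v], hence of the
    form [dot u v]. *)
Lemma ultra_bounded_weak_cvg {T : Type} (G : set_system T) (x : T -> H) (M : R) :
  UltraFilter G -> (\forall t \near G, `|x t| <= M) ->
  exists u, weak_cvg dot G x u.
Proof.
move=> GU GM; have GP := @ultra_proper _ _ GU.
have bound v : \forall t \near G, `|dot (x t) v| <= M * `|v|.
  apply: filterS GM => t xM; apply: le_trans (dot_le norm_dot _ _) _.
  exact: ler_wpM2r.
have lim_ex v : exists r : R, dot (x t) v @[t --> G] --> r.
  have := @segment_compact R (- (M * `|v|)) (M * `|v|); rewrite compact_ultra.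
  move=> /(_ _ (ultra_fmap (fun t => dot (x t) v) GU)) [|r [_ xr]]; last by exists r.
  by apply: filterS (bound v) => t; rewrite /= in_itv/= ler_norml.
have [phi phiP] := choice lim_ex.
have [||u phiE] := @riesz_representation phi M.
- move=> a v w; apply: (cvg_unique _ (phiP (a *: v + w))); first exact: norm_hausdorff.
  rewrite /=; under eq_fun do rewrite dotDr dotZr.
  by apply: cvgD => //; apply: cvgMr.
- move=> v; apply: (closed_cvg (u_ := fun t => `|dot (x t) v|) (fun r => r <= M * `|v|)
    (@closed_le _ _) (bound v)).
  exact: cvg_norm.
by exists u => v; rewrite -phiE.
Qed.

(** A filter is the intersection of the ultrafilters above it: if [A] is not in
    [F], then [F] restricted to the complement of [A] is proper. This reduces
    convergence along [F] to convergence along ultrafilters. *)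
Lemma near_ultra {T : Type} (F : set_system T) {FF : Filter F} (A : set T) :
  (forall G, UltraFilter G -> F `<=` G -> G A) -> F A.
Proof.
move=> FA; apply: contrapT => nFA.
have PF : ProperFilter (within (~` A) F).
  split; last exact: within_filter.
  by rewrite /within/= => FA0; apply: nFA; apply: filterS FA0 => t; apply: contrapT.
have [G [GU sub]] := ultraFilterLemma PF; have GP := @ultra_proper _ _ GU.
have GA : G A.
  by apply: FA => // B FB; apply: sub; rewrite /within/=; apply: filterS FB => t Bt _.
have GA' : G (~` A) by apply: sub; exact: withinT.
have : G (A `&` ~` A) by exact: filterI.
by move=> /filter_ex[t []].
Qed.

(** Two weak limits [u] and [l] in [S], along two ultrafilters, coincide:
    [|x t - l|^2 - |x t - u|^2] converges along [F], and up to a constant it is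
    [2 dot (x t) (u - l)]; so [dot u (u - l)] and [dot l (u - l)] are the same
    limit. *)
Lemma opial {T : Type} (F : set_system T) {FF : ProperFilter F} (x : T -> H)
    (S : set H) :
  S !=set0 -> (forall z, S z -> cvg (`|x t - z| @[t --> F])) ->
  (forall G u, UltraFilter G -> F `<=` G -> weak_cvg dot G x u -> S u) ->
  exists2 l, S l & weak_cvg dot F x l.
Proof.
move=> [z0 Sz0] dist_cvg cluster_S.
have [M bound] : exists M, \forall t \near F, `|x t| <= M.
  exists (lim (`|x t - z0| @[t --> F]) + 1 + `|z0|).
  have /cvgrPdist_le/(_ 1 ltr01) := dist_cvg _ Sz0; apply: filterS => t.
  rewrite ler_distlC => /andP[_ le]; rewrite -[x t](subrK z0).
  by apply: le_trans (ler_normD _ _) _; rewrite lerD2r.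
have weak_ex G : UltraFilter G -> F `<=` G -> exists2 u, S u & weak_cvg dot G x u.
  move=> GU FG; have [u xu] := ultra_bounded_weak_cvg GU (FG _ bound).
  by exists u => //; exact: cluster_S xu.
have [G0 [G0U FG0]] := ultraFilterLemma FF.
have [l Sl xl] := weak_ex G0 G0U FG0; exists l => // v.
apply/cvgrPdist_lt => e e0; apply: near_ultra => G GU FG.
have [u Su xu] := weak_ex G GU FG.
suff ul : u = l by have /cvgrPdist_lt := xu v; rewrite ul; apply.
have [r xr] : exists r : R, dot (x t) (u - l) @[t --> F] --> r.
  have polar t : dot (x t) (u - l)
      = (`|x t - l| ^+ 2 - `|x t - u| ^+ 2 + (`|u| ^+ 2 - `|l| ^+ 2)) * 2^-1.
    by rewrite !(sqr_normB norm_dot) dotDr dotNr; field.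
  eexists; under eq_fun do rewrite polar.
  apply: cvgMl; apply: cvgD; last exact: cvg_cst.
  by apply: cvgB; apply: cvgM; exact: dist_cvg.
have lim_eq K w : ProperFilter K -> F `<=` K -> weak_cvg dot K x w -> dot w (u - l) = r.
  move=> KP FK xw; apply: (cvg_unique _ (xw (u - l))); first exact: norm_hausdorff.
  by rewrite /=; apply: cvg_trans xr; apply: cvg_app.
have : dot (u - l) (u - l) = 0.
  have [GP G0P] := (@ultra_proper _ _ GU, @ultra_proper _ _ G0U).
  by rewrite dotDl dotNl (lim_eq G u GP FG xu) (lim_eq G0 l G0P FG0 xl) subrr.
by rewrite -norm_dot => /eqP; rewrite sqrf_eq0 normr_eq0 subr_eq0 => /eqP.
Qed.
End weak_limits.

(** * Averages *)

Section averages.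
Context {R : realType}.

(** The equation says that [s^b (w s - mu)] has derivative
    [b s^(b - 1) (p s - mu)], which is eventually nonpositive. So
    [s^b (w s - mu)] stays bounded above, while [s^b] tends to infinity. *)
Lemma average_ubound (w p : R -> R) (b mu s0 : R) : 0 < b -> 0 < s0 ->
  (forall s, s0 < s -> is_derive s 1 w (b / s * (p s - w s))) ->
  (\forall s \near +oo, p s <= mu) ->
  forall e, 0 < e -> \forall s \near +oo, w s <= mu + e.
Proof.
move=> b0 s00 dw [A0 [_ pA0]] e e0; pose A := Num.max A0 s0 + 1.
have [A0A s0A] : A0 < A /\ s0 < A.
  by split; rewrite /A ltr_pwDr// le_max lexx ?orbT.
pose phi : R -> R := fun s => s `^ b * (w s - mu).
have gt0_A s : A <= s -> 0 < s by move=> As; apply: lt_le_trans As; exact: lt_trans s0A.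
have dphi s : A <= s -> is_derive s 1 phi (b * s `^ (b - 1) * (p s - mu)).
  move=> As; have s_gt0 := gt0_A s As.
  have dws := dw s (lt_le_trans s0A As).
  have dws' := is_deriveB dws (is_derive_cst mu s 1).
  apply: is_derive_eq (is_deriveM (is_derive1_powR b s_gt0) dws') _.
  rewrite subr0 -(mulr_powRB1 (ltW s_gt0) b0) /GRing.scale/=.
  by rewrite !fctE; field; rewrite gt_eqF.
have phi_le s : A <= s -> phi s <= phi A.
  move=> As; apply: (@ler0_derive1_nincry R phi A) => // t.
  - by rewrite in_itv/= andbT => /ltW/dphi[].
  - rewrite in_itv/= andbT => At; rewrite derive1E; have [_ ->] := dphi t (ltW At).
    rewrite mulr_ge0_le0 ?mulr_ge0 ?powR_ge0 ?(ltW b0)// subr_le0 pA0//.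
    exact: lt_trans At.
  - by apply: derivable_within_continuous => t'; rewrite in_itv/= andbT => /dphi[].
(* From [N] on the weight [s^b] is at least [|phi A| / e]. *)
pose N := (`|phi A| / e) `^ b^-1.
near=> s.
have As : A <= s by near: s; apply: nbhs_pinfty_ge; exact: num_real.
have Ns : N <= s by near: s; apply: nbhs_pinfty_ge; exact: num_real.
have sb0 : 0 < s `^ b by apply: powR_gt0; exact: gt0_A.
have Nsb : `|phi A| <= e * s `^ b.
  rewrite mulrC -ler_pdivrMr//.
  have -> : `|phi A| / e = N `^ b.
    by rewrite -powRrM mulVf ?gt_eqF// powRr1// divr_ge0// ltW.
  by apply: ge0_ler_powR; rewrite ?nnegrE ?powR_ge0 ?(ltW b0) ?(ltW (gt0_A s As)).
rewrite -lerBlDl -(ler_pM2l sb0); apply: le_trans (phi_le s As) _.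
by apply: le_trans (ler_norm _) _; rewrite mulrC.
Unshelve. all: by end_near. Qed.

Lemma average_cvg (w p : R -> R) (b l s0 : R) : 0 < b -> 0 < s0 ->
  (forall s, s0 < s -> is_derive s 1 w (b / s * (p s - w s))) ->
  p s @[s --> +oo] --> l -> w s @[s --> +oo] --> l.
Proof.
move=> b0 s00 dw pl; apply/cvgrPdist_le => e e0.
have e2 : 0 < e / 2 by rewrite divr_gt0.
have near_p : \forall s \near +oo, `|l - p s| <= e / 2 by move/cvgrPdist_le : pl; apply.
have ub : \forall s \near +oo, w s <= l + e / 2 + e / 2.
  apply: (average_ubound (p := p)) => //; apply: filterS near_p => s.
  by rewrite ler_distlC => /andP[].
have lb : \forall s \near +oo, - w s <= - l + e / 2 + e / 2.
  apply: (@average_ubound (- w) (- p) b _ s0) => // [s s0s|].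
    by apply: is_derive_eq (is_deriveN (dw s s0s)) _; rewrite !fctE; ring.
  by apply: filterS near_p => s; rewrite ler_distlC => /andP[? _]; rewrite fctE; lra.
apply: filterS2 ub lb => s ub lb; rewrite ler_distlC; apply/andP; split; lra.
Qed.

(** Inside the half-line the one-sided restriction in [derive_from] is invisible
    to small increments, so the derivative is the usual two-sided one. *)
Lemma is_derive_dot {H : completeNormedModType R} (dot : {dot H for idfun})
    (norm_dot : forall u : H, `|u| ^+ 2 = dot u u) (s0 s : R) (x : R -> H) (v : H) :
  s0 < s -> derivable_from s0 x s ->
  is_derive s 1 (fun t => dot (x t) v) (dot (derive_from s0 x s) v).
Proof.
move=> s0s dx; set D := derive_from s0 x s.
have FF : Filter (within `[s0, +oo[ (s^')) by exact: within_filter.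
have qD : dot (diff_quot x s t) v @[t --> within `[s0, +oo[ (s^')] --> dot D v.
  by apply: cvg_dot => //; exact: cvg_cst.
have : h^-1 *: (dot (x (h *: 1 + s)) v - dot (x s) v) @[h --> 0^'] --> (dot D v : R^o).
  apply/cvgrPdist_le => e e0; move/cvgrPdist_le : qD => /(_ e e0).
  move=> /nbhs_ballP[d /= d0 dq].
  apply/nbhs_ballP; exists (Num.min d (s - s0)) => /= [|h].
    by rewrite lt_min d0 subr_gt0.
  rewrite -ball_normE/= sub0r normrN lt_min => /andP[hd hs] h0.
  have -> : h *: (1 : R) = h by rewrite -[h *: 1]/(h * 1) mulr1.
  have -> : h^-1 *: (dot (x (h + s)) v - dot (x s) v) = dot (diff_quot x s (h + s)) v.
    by rewrite /diff_quot addrK dotZl dotDl dotNl.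
  apply: dq.
  - by rewrite -ball_normE/= opprD addrCA subrr addr0 normrN.
  - by rewrite -subr_eq0 addrK.
  - by rewrite /= in_itv/= andbT; move: hs; rewrite ltr_norml; lra.
move=> cv; split; first by apply/cvg_ex; exists (dot D v).
by rewrite /derive; apply: cvg_lim.
Qed.
End averages.

(** * The steepest descent flow *)

Section flow.
Context {R : realType} {H : completeNormedModType R} (dot : {dot H for idfun}).
Hypothesis norm_dot : forall u : H, `|u| ^+ 2 = dot u u.
Context (f : H -> \bar R).
Hypotheses (f_proper : proper_fun f) (f_lsc : lower_semicontinuous f).
Context (c s0 : R) (y : R -> H).
Hypotheses (c_gt0 : 0 < c) (s0_gt0 : 0 < s0).
Hypotheses (y_ac : loc_abs_continuous s0 y)
  (y_cont : {within `[s0, +oo[, continuous y}).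
Hypothesis y_flow : {ae (@lebesgue_measure R), forall s, s0 <= s ->
  derivable_from s0 y s /\
  exists2 xi, subdiff dot f (y s) xi & derive_from s0 y s + (s * c) *: xi = 0}.

Lemma subdiff_fin_num u xi : subdiff dot f u xi -> f u \is a fin_num.
Proof.
case: f_proper => fNy [w fw] /(_ w) /le_lt_trans /(_ fw).
by rewrite fin_numE fNy; case: (f u).
Qed.

Lemma cvg_flow s : s0 <= s -> y @ within `[s0, +oo[ (nbhs s) --> y s.
Proof.
move=> s0s; have /subspace_continuousP := y_cont; apply.
by rewrite /= in_itv/= s0s.
Qed.

Lemma flow_bounded v a b : s0 <= a -> a <= b ->
  exists2 M, 0 <= M & forall s, a <= s <= b -> `|y s - v| <= M.
Proof.
move=> s0a ab; have cont : {within `[a, b], continuous (fun s => `|y s - v|)}.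
  apply/subspace_continuousP => s /=; rewrite in_itv/= => /andP[sa sb].
  apply: cvg_norm; apply: cvgB; last exact: cvg_cst.
  apply: cvg_trans (cvg_flow (le_trans s0a sa)); apply: cvg_app.
  apply: within_subset => t /=; rewrite !in_itv/= => /andP[at_ _].
  by rewrite (le_trans s0a).
have [m mab max] := EVT_max ab cont.
by exists `|y m - v| => // s sab; apply: max; rewrite in_itv.
Qed.

(** The basic inequality of the flow. Where [y' = - c s xi] with [xi] a
    subgradient at [y s], the function [|y s - v|^2 - k c s^2] has derivative
    [2 c s (dot xi (v - y s) - k)], and
    [dot xi (v - y s) <= f v - f (y s) <= k]. It is absolutely continuous on
    [[a, b]] because [y] is, and is bounded there. *)
Lemma flow_sqdist_le a b v k : s0 <= a -> a <= b ->
  (forall s, a <= s <= b -> (f v <= f (y s) + k%:E)%E) ->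
  `|y b - v| ^+ 2 - k * c * b ^+ 2 <= `|y a - v| ^+ 2 - k * c * a ^+ 2.
Proof.
move=> s0a ab fvk; pose g s := `|y s - v| ^+ 2 - k * c * s ^+ 2.
have [c0 s00] := (c_gt0, s0_gt0).
apply: (@ac_nonincreasing _ g) => //.
  have [M M0 yM] := flow_bounded v s0a ab.
  apply: (@abs_continuous_dominated _ _ _ y _ _ _ (2 * M + 2 * `|k * c| * b)).
  - by rewrite addr_ge0 ?mulr_ge0 ?mulr_ge0//; lra.
  - move=> l r al lr rb; rewrite /g.
    set p := y r - v; set q := y l - v.
    have -> : y r - y l = p - q by rewrite /p /q opprB addrA subrK.
    have pM : `|p| <= M by apply: yM; rewrite rb (le_trans al lr).
    have qM : `|q| <= M by apply: yM; rewrite al (le_trans lr rb).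
    have -> : `|p| ^+ 2 - k * c * r ^+ 2 - (`|q| ^+ 2 - k * c * l ^+ 2)
       = dot (p - q) (p + q) - (k * c) * ((r - l) * (r + l)).
      by rewrite -(sqr_norm_sub norm_dot); ring.
    apply: le_trans (ler_normB _ _) _.
    have h1 : `|dot (p - q) (p + q)| <= `|p - q| * (2 * M).
      apply: le_trans (dot_le norm_dot _ _) _; apply: ler_wpM2l => //.
      by apply: le_trans (ler_normD _ _) _; lra.
    have h2 : `|k * c * ((r - l) * (r + l))| <= `|k * c| * ((r - l) * (2 * b)).
      rewrite normrM ler_wpM2l// ger0_norm ?mulr_ge0//; [|lra|lra].
      by rewrite ler_wpM2l//; lra.
    have h3 : 0 <= (r - l) * (2 * M) by rewrite mulr_ge0; lra.
    have h4 : 0 <= `|p - q| * (2 * `|k * c| * b) by rewrite !mulr_ge0//; lra.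
    lra.
  - exact: y_ac.
apply: (@filterS _ _ (ae_filter_ringOfSetsType _) _ _ _ y_flow) => s flow_s.
move=> /andP[sa sb] e e0.
have s0s := le_trans s0a sa.
have {flow_s} [Dy [xi xi_s Dxi]] := flow_s s0s.
set D := derive_from s0 y s in Dxi; pose F := within `[s0, +oo[ (s^').
have FF : Filter F by apply: within_filter.
have qD : diff_quot y s t @[t --> F] --> D by exact: Dy.
have Fid : id @ F --> s.
  by move=> A sA; rewrite /F /dnbhs /within/=; apply: filterS sA => t At _ _.
have Fy : y @ F --> y s.
  apply: cvg_trans (cvg_flow s0s); apply: cvg_app.
  move=> A WA.
  have {}WA : nbhs s (fun t => `[s0, +oo[%classic t -> A t) by exact: WA.
  by rewrite /F /dnbhs /within/=; apply: filterS WA => t h _.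
(* [Q] is the difference quotient of [g] at [s], in factored form. *)
pose Q t := dot (diff_quot y s t) (y t - v + (y s - v)) - k * c * (t + s).
have QM : Q t @[t --> F] --> dot D (y s - v + (y s - v)) - k * c * (s + s).
  apply: cvgB.
    apply: cvg_dot => //; apply: cvgD; last exact: cvg_cst.
    by apply: cvgB => //; exact: cvg_cst.
  by apply: cvgMr; apply: cvgD => //; exact: cvg_cst.
have M0 : dot D (y s - v + (y s - v)) - k * c * (s + s) <= 0.
  have -> : D = - ((s * c) *: xi) by apply/eqP; rewrite -addr_eq0 Dxi.
  have : dot xi (v - y s) <= k.
    have ys_fin := subdiff_fin_num xi_s.
    have := le_trans (xi_s v) (fvk s _); rewrite sa sb => /(_ isT).
    by rewrite -(fineK ys_fin) -!EFinD lee_fin lerD2l.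
  rewrite !(dotE dot) => xik.
  have : 0 <= 2 * (s * c) * (k - (dot xi v - dot xi (y s))).
    by rewrite !mulr_ge0 ?subr_ge0//; lra.
  lra.
have : \forall t \near F, Q t < e.
  by apply: (cvgr_lt _ QM); apply: le_lt_trans M0 e0.
rewrite /F /dnbhs !near_withinE; apply: filterS => t Qe ts.
rewrite /= in_itv/= => /andP[ta tb].
have {}Qe : Q t < e by apply: Qe => //; rewrite /= in_itv/= (le_trans s0a).
apply/ltW; move: Qe; rewrite /Q /diff_quot dotZl.
suff -> : g t - g s
    = dot (y t - y s) (y t - v + (y s - v)) - k * c * (t - s) * (t + s).
  rewrite mulrBr.
  suff -> : (t - s)^-1 * (k * c * (t - s) * (t + s)) = k * c * (t + s) by [].
  by field; rewrite subr_eq0.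
rewrite (_ : y t - y s = y t - v - (y s - v)); last by rewrite opprB addrA subrK.
by rewrite -(sqr_norm_sub norm_dot) /g; ring.
Qed.

(** Were [f (y b) > f (y a)], let [t] be the last time in [[a, b]] with
    [f (y t) <= f (y a)]. On [[t, b]] the values are at least [f (y t)], so the
    basic inequality with [v = y t] and [k = 0] forces [y b = y t]. *)
Lemma flow_value_nonincreasing a b : s0 <= a -> a <= b -> (f (y b) <= f (y a))%E.
Proof.
move=> s0a ab; rewrite leNgt; apply/negP => fab.
have [r fa] : exists r : R, f (y a) = r%:E.
  move: fab (f_proper.1 (y a)); case: (f (y a)) => [r _ _|//|//]; first by exists r.
  by rewrite ltNge leey.
rewrite fa in fab; pose S := [set t | a <= t <= b /\ (f (y t) <= r%:E)%E].
have Sa : S a by split; rewrite ?lexx ?fa.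
have supS : has_sup S by split; [exists a|exists b => t [/andP[]]].
pose t := sup S.
have Sle u : S u -> u <= t by apply: (sup_ubound supS.2).
have at_ : a <= t := Sle _ Sa.
have tb : t <= b by apply: ge_sup; [exists a|move=> u [/andP[]]].
(* The supremum [t] belongs to [S] because [f] is lower semicontinuous and [y]
   is continuous. *)
have ft : (f (y t) <= r%:E)%E.
  rewrite leNgt; apply/negP => /f_lsc[V Vy fV].
  have /nbhs_ballP[d /= d0 dV] := cvg_flow (le_trans s0a at_) Vy.
  have [u [uab fu] tu] := sup_adherent d0 supS.
  have := fV (y u); rewrite ltNge fu => /(_ _)/negP; apply => //.
  apply: dV; last by rewrite /= in_itv/= andbT; case/andP: uab => /(le_trans s0a).
  have ut : u <= t by apply: Sle.
  by rewrite /ball/= ger0_norm ?subr_ge0//; move: tu; rewrite -/t; lra.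
have : `|y b - y t| ^+ 2 - 0 * c * b ^+ 2 <= `|y t - y t| ^+ 2 - 0 * c * t ^+ 2.
  apply: flow_sqdist_le => //; first exact: le_trans at_.
  move=> s /andP[ts sb]; rewrite adde0.
  move: ts; rewrite le_eqVlt => /predU1P[<-//|ts].
  apply: le_trans ft _; rewrite leNgt; apply/negP => /ltW fs.
  suff : s <= t by rewrite leNgt ts.
  by apply: Sle; split=> //; rewrite sb (le_trans at_)// ltW.
rewrite !mul0r !subr0 subrr normr0 expr0n/= => ybt.
have /eqP : `|y b - y t| ^+ 2 = 0 by apply/eqP; rewrite eq_le ybt sqr_ge0.
rewrite sqrf_eq0 normr_eq0 subr_eq0 => /eqP ybE.
by move: fab; rewrite ybE ltNge ft.
Qed.

Hypothesis f_init : edom f (y s0).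

Lemma flow_value_fin_num s : s0 <= s -> f (y s) \is a fin_num.
Proof.
move=> s0s; rewrite fin_numE f_proper.1/= -ltey.
exact: le_lt_trans (flow_value_nonincreasing (lexx _) s0s) f_init.
Qed.

Definition value_gap (z : H) (s : R) := fine (f (y s)) - fine (f z).

Section minimizer.
Context (z : H).
Hypothesis z_min : argmin f z.

Lemma argmin_fin_num : f z \is a fin_num.
Proof.
rewrite fin_numE f_proper.1/= -ltey.
exact: le_lt_trans (z_min (y s0)) f_init.
Qed.

Lemma value_gap_ge0 s : s0 <= s -> 0 <= value_gap z s.
Proof.
move=> s0s; rewrite subr_ge0 fine_le ?argmin_fin_num ?flow_value_fin_num//.
Qed.

(** The basic inequality at a minimizer with [k = - value_gap z b]: as the values
    decrease, every gap before time [b] is at least the one at [b]. *)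
Lemma value_gap_decrease a b : s0 <= a -> a <= b ->
  c * (b ^+ 2 - a ^+ 2) * value_gap z b <= `|y a - z| ^+ 2 - `|y b - z| ^+ 2.
Proof.
move=> s0a ab.
suff : `|y b - z| ^+ 2 - (- value_gap z b) * c * b ^+ 2
    <= `|y a - z| ^+ 2 - (- value_gap z b) * c * a ^+ 2.
  by lra.
apply: flow_sqdist_le => // s /andP[as_ sb].
have s0s := le_trans s0a as_.
have := flow_value_nonincreasing s0s sb.
have fb : f (y b) \is a fin_num by apply: flow_value_fin_num; exact: le_trans sb.
rewrite -(fineK fb) -(fineK (flow_value_fin_num s0s)) -(fineK argmin_fin_num).
by rewrite -EFinD !lee_fin /value_gap; lra.
Qed.

Lemma flow_fejer a b : s0 <= a -> a <= b -> `|y b - z| <= `|y a - z|.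
Proof.
move=> s0a ab; rewrite -(@ler_pXn2r _ 2) ?nnegrE//.
have [c0 s00] := (c_gt0, s0_gt0).
have := value_gap_decrease s0a ab; have : 0 <= c * (b ^+ 2 - a ^+ 2) * value_gap z b.
  apply: mulr_ge0; last by apply: value_gap_ge0; exact: le_trans ab.
  by apply: mulr_ge0; [lra|rewrite subr_ge0 lerXn2r ?nnegrE//; lra].
lra.
Qed.

Lemma flow_dist_cvg : cvg (`|y s - z| @[s --> +oo]).
Proof.
pose D := [set `|y s - z| | s in `[s0, +oo[].
have infD : has_inf D.
  split; first by exists `|y s0 - z|, s0; rewrite //= in_itv/= lexx.
  by exists 0 => _ [s _ <-].
apply/cvg_ex; exists (inf D); apply/cvgrPdist_le => /= e e0.
have [_ [a + <-] ae] := inf_adherent e0 infD; rewrite /= in_itv/= andbT => s0a.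
near=> s; have as_ : a <= s by near: s; apply: nbhs_pinfty_ge; exact: num_real.
rewrite ler_distlC.
have : inf D <= `|y s - z|.
  apply: (inf_lbound infD.2); exists s => //.
  by rewrite /= in_itv/= (le_trans s0a).
have := flow_fejer s0a as_; move=> ? ?; apply/andP; split; lra.
Unshelve. all: by end_near. Qed.

(** Apply [value_gap_decrease] on [[s / 2, s]]: its right-hand side is a Cauchy
    difference of the convergent function [|y s - z|^2], its left-hand side is
    [3 / 4 * c] times [s^2] times the gap. *)
Lemma value_gap_small_o e : 0 < e -> \forall s \near +oo, s ^+ 2 * value_gap z s <= e.
Proof.
move=> e0; have c0 := c_gt0.
have sqcvg : `|y s - z| ^+ 2 @[s --> +oo] --> lim (`|y s - z| @[s --> +oo]) ^+ 2.
  by apply: cvgM; exact: flow_dist_cvg.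
have e'0 : 0 < 3 / 8 * c * e by rewrite !mulr_gt0.
have [A [_ yA]] : \forall s \near +oo,
    `|lim (`|y s - z| @[s --> +oo]) ^+ 2 - `|y s - z| ^+ 2| <= 3 / 8 * c * e.
  by move/cvgrPdist_le: sqcvg; apply.
near=> s.
have s0s : s0 <= s / 2.
  by rewrite ler_pdivlMr//; near: s; apply: nbhs_pinfty_ge; exact: num_real.
have As : A < s / 2.
  by rewrite ltr_pdivlMr//; near: s; apply: nbhs_pinfty_gt; exact: num_real.
have ss : s / 2 <= s by have := s0_gt0; lra.
have := value_gap_decrease s0s ss.
have -> : c * (s ^+ 2 - (s / 2) ^+ 2) * value_gap z s
    = 3 / 4 * c * (s ^+ 2 * value_gap z s) by field.
have := yA _ As; have := yA _ (lt_le_trans As ss).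
rewrite !ler_distlC => /andP[h1 h2] /andP[h3 h4] h5.
rewrite -(ler_pM2l (mulr_gt0 (_ : 0 < 3 / 4) c0))//; lra.
Unshelve. all: by end_near. Qed.
End minimizer.

Hypotheses (f_convex : econvex f) (f_argmin : argmin f !=set0).

(** Weak cluster points are minimizers, since they lie in every sublevel set
    above the minimum; Opial's argument concludes. *)
Lemma flow_weak_cvg : exists2 l, argmin f l & weak_cvg dot +oo y l.
Proof.
have [z z_min] := f_argmin; apply: opial => //.
  by move=> z'; exact: flow_dist_cvg.
move=> G u GU FG yu v; have GP := @ultra_proper _ _ GU.
apply: le_trans (z_min v); apply/lee_addgt0Pr => e e0.
rewrite -(fineK (argmin_fin_num z_min)) -EFinD.
pose C := [set w | (f w <= (fine (f z) + e)%:E)%E].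
apply: (@closed_convex_weak_closed _ _ dot norm_dot _ G GP y u C) => //.
- exact: closed_sublevel.
- by move=> w1 w2 t; exact: convex_sublevel.
apply: FG; near=> s.
have s0s : s0 <= s by near: s; apply: nbhs_pinfty_ge; exact: num_real.
have s1 : 1 <= s by near: s; apply: nbhs_pinfty_ge; exact: num_real.
have gap_e : s ^+ 2 * value_gap z s <= e by near: s; exact: value_gap_small_o.
rewrite /C/= -(fineK (flow_value_fin_num s0s)) lee_fin addrC -lerBlDr.
apply: le_trans gap_e; rewrite ler_peMl ?value_gap_ge0// exprn_ege1//.
Unshelve. all: by end_near. Qed.
End flow.

(** * The second-order trajectory *)

Theorem theorem8 (R : realType) (H : completeNormedModType R)
  (dot : {dot H for idfun})
  (norm_dot : forall u : H, `|u| ^+ 2 = dot u u)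
  (f : H -> \bar R)
  (f_proper : proper_fun f)
  (f_lsc : lower_semicontinuous f)
  (f_convex : econvex f)
  (f_argmin : argmin f !=set0)
  (s0 alpha : R) (s0_gt0 : 0 < s0) (alpha_gt1 : 1 < alpha)
  (x : R -> H)
  (x_sol : solution_trajectory dot f alpha s0 x)
  (x_init : edom f (x s0))
  (dx_init : derive_from s0 x s0 = 0) :
  let y := y_of alpha s0 x in
  (exists2 l : H, argmin f l & weak_cvg dot +oo x l) /\
  (3 < alpha ->
    (\forall s \near +oo, f (y s) \is a fin_num) /\
    (fun s : R => fine (f (y s) - ereal_inf (range f))%E)
      =o_+oo (fun s : R => 1 / s ^+ 2)).
Proof.
move=> y; have [[y_ac y_cont] _ y_flow x_ode] := x_sol.
rewrite -/y in y_ac y_cont y_flow x_ode.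
have a0 : 0 < alpha - 1 by rewrite subr_gt0.
have c0 : 0 < (alpha - 1)^-1 by rewrite invr_gt0.
have y_init : edom f (y s0) by rewrite /y /y_of dx_init scaler0 addr0.
split.
  have [l l_min yl] := flow_weak_cvg norm_dot f_proper f_lsc c0 s0_gt0 y_ac y_cont
    y_flow y_init f_convex f_argmin.
  exists l => // v; apply: (average_cvg a0 s0_gt0 _ (yl v)) => s s0s.
  have [dx /eqP] := x_ode s (ltW s0s); rewrite addr_eq0 => /eqP dxE.
  apply: is_derive_eq (is_derive_dot norm_dot v s0s dx) _.
  by rewrite dxE dotNl dotZl dotDl dotNl; ring.
move=> _; have [z z_min] := f_argmin.
have y_fin s : s0 <= s -> f (y s) \is a fin_num.
  exact: (flow_value_fin_num norm_dot f_proper f_lsc c0 s0_gt0 y_ac y_cont y_flow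
    y_init).
have inf_z : ereal_inf (range f) = f z.
  apply/eqP; rewrite eq_le; apply/andP; split.
    by apply: ereal_inf_lbound; exists z.
  by apply: le_ereal_inf_tmp => _ [u _ <-].
have z_fin := argmin_fin_num f_proper y_init z_min.
split; first by near=> s; apply: y_fin; near: s; apply: nbhs_pinfty_ge; exact: num_real.
apply/eqoP => e e0; near=> s.
have s0s : s0 <= s by near: s; apply: nbhs_pinfty_ge; exact: num_real.
have s_gt0 := lt_le_trans s0_gt0 s0s.
have gap_e : s ^+ 2 * value_gap f y z s <= e.
  near: s.
  exact: (value_gap_small_o norm_dot f_proper f_lsc c0 s0_gt0 y_ac y_cont y_flow
    y_init z_min e0).
have gap0 := value_gap_ge0 norm_dot f_proper f_lsc c0 s0_gt0 y_ac y_cont y_flow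
  y_init z_min s0s.
rewrite inf_z fineB ?y_fin// ger0_norm// ger0_norm ?divr_ge0 ?sqr_ge0//.
by rewrite mulrA mulr1 ler_pdivlMr ?exprn_gt0// mulrC.
Unshelve. all: by end_near. Qed.
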